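(* Let $(L,\cdot,[\;,\;])$ be a transposed Poisson algebra. Let $f$ be an endomorphism of the algebra $(L,\cdot)$ satisfying $f^2=\mathrm{id}$ (that is, $f$ is an involutive endomorphism of $(L,\cdot)$) and $$f([x,y])=-[f(x),f(y)],\quad\forall x,y\in L.$$ Define a ternary operation on $L$ by $$[x,y,z]:=f(x)\cdot[y,z]+f(y)\cdot[z,x]+f(z)\cdot[x,y],\quad\forall x,y,z\in L.$$ Then $(L,[\;,\;,\;])$ is a 3-Lie algebra.
   Context: All vector spaces are over a field $K$ of characteristic zero. Commutative associative algebras are not assumed unital. An endomorphism of $(L,\cdot)$ is a $K$-linear map $f:L\to L$ with $f(x\cdot y)=f(x)\cdot f(y)$. A transposed Poisson algebra is a triple $(L,\cdot,[\;,\;])$ where $(L,\cdot)$ is a commutative associative algebra, $(L,[\;,\;])$ is a Lie algebra, and $2z\cdot[x,y]=[z\cdot x,y]+[x,z\cdot y]$ for all $x,y,z\in L$. A 3-Lie algebra is a vector space $A$ with a skew-symmetric trilinear map $[\;,\;,\;]:\otimes^3A\to A$ such that, for all $x,y,z,u,v\in A$, $$[[x,y,z],u,v]=[[x,u,v],y,z]+[[y,u,v],z,x]+[[z,u,v],x,y].$$ *)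

(* Defs.v *)
From mathcomp Require Import all_boot all_algebra.

Set Implicit Arguments.
Unset Strict Implicit.
Unset Printing Implicit Defensive.

Import GRing.Theory.
Local Open Scope ring_scope.

(* MathComp's algebra structures are unital, hence the explicit products on a
   vector space, of possibly infinite dimension. *)
Definition comm_assoc_algebra (K : fieldType) (L : lmodType K)
    (mul : {bilinear L -> L -> L}) : Prop :=
  (forall x y : L, mul x y = mul y x) /\
  (forall x y z : L, mul (mul x y) z = mul x (mul y z)).

Definition lie_algebra (K : fieldType) (L : lmodType K)
    (br : {bilinear L -> L -> L}) : Prop :=
  (forall x : L, br x x = 0) /\
  (forall x y z : L, br x (br y z) + br y (br z x) + br z (br x y) = 0).

Definition transposed_poisson_algebra (K : fieldType) (L : lmodType K)
    (mul br : {bilinear L -> L -> L}) : Prop :=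
  [/\ comm_assoc_algebra mul,
      lie_algebra br
    & forall x y z : L,
        2%:R *: mul z (br x y) = br (mul z x) y + br x (mul z y)].

Definition trilinear (K : fieldType) (A : lmodType K)
    (t : A -> A -> A -> A) : Prop :=
  [/\ forall y z : A, linear (fun x : A => t x y z),
      forall x z : A, linear (fun y : A => t x y z)
    & forall x y : A, linear (fun z : A => t x y z)].

Definition skew_symmetric3 (K : fieldType) (A : lmodType K)
    (t : A -> A -> A -> A) : Prop :=
  forall x y z : A,
    [/\ t y x z = - t x y z, t x z y = - t x y z & t z y x = - t x y z].

Definition three_lie_algebra (K : fieldType) (A : lmodType K)
    (t : A -> A -> A -> A) : Prop :=
  [/\ trilinear t,
      skew_symmetric3 t
    & forall x y z u v : A,
        t (t x y z) u v = t (t x u v) y z + t (t y u v) z x + t (t z u v) x y].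

(* Main.v *)
Require Import Defs.
From mathcomp Require Import all_boot all_algebra.
Import GRing.Theory.
Local Open Scope ring_scope.

(** Write [x'] for [f x].  Since [f] turns brackets into opposite brackets,
    expanding the two sides of the fundamental identity gives only terms with
    two products and two brackets of the letters [x, y, z, u, v], exactly two
    of which are primed.  The identity then splits according to the set of
    primed letters, and each piece holds in any transposed Poisson algebra, with
    the primed letters regarded as independent elements:
    - for [{u', v'}], it is the product by [[u', v']] of
      [x[y,z] + y[z,x] + z[x,y] = 0] ([cyclic_mul_br]);
    - for [{x', y'}], it is [a[z, bw] - b[z, aw] = wz[a, b]] ([mul_br_swap])
      with [a = x'], [b = y'] and [w = [u, v]];
    - for [{x', u'}], the same law with [a = x'], [b = u'] and [w = [y, z]]
      turns it into the product by [x'] of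
      [[h[x,y], z] + [h[y,z], x] + [h[z,x], y] = 0] ([cyclic_br_mul_br])
      taken at [h = u'] and the letters [y, z, v].
    The other sets of primed letters follow by cycling [x, y, z] and by
    exchanging [u] and [v].  Characteristic zero only serves to divide by 2. *)

(** * Equalities between integer combinations in an abelian group *)

(** Formal sums and opposites of variables, which are numbered from 0. *)
Inductive zexpr : Type :=
| ZVar of nat
| ZZero
| ZAdd of zexpr & zexpr
| ZOpp of zexpr.

(** The value of a formal expression, for variables listed in [e]; the variables
    beyond the end of [e] are worth 0. *)
Fixpoint zeval (V : zmodType) (e : seq V) (t : zexpr) : V :=
  match t with
  | ZVar n => e`_n
  | ZZero => 0
  | ZAdd t1 t2 => zeval V e t1 + zeval V e t2
  | ZOpp t1 => - zeval V e t1
  end.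

(** The coefficient of the variable number [i] in a formal expression. *)
Fixpoint zcoef (t : zexpr) (i : nat) : int :=
  match t with
  | ZVar n => if n == i then 1 else 0
  | ZZero => 0
  | ZAdd t1 t2 => zcoef t1 i + zcoef t2 i
  | ZOpp t1 => - zcoef t1 i
  end.

Lemma zevalE (V : zmodType) (e : seq V) (t : zexpr) :
  zeval V e t = \sum_(i < size e) e`_i *~ zcoef t i.
Proof.
elim: t => [n||t1 IH1 t2 IH2|t1 IH1] /=.
- case: (ltnP n (size e)) => [lt_ne | le_en].
    rewrite (bigD1 (Ordinal lt_ne)) //= eqxx mulr1z big1 ?addr0 // => i.
    by rewrite -val_eqE /= eq_sym => /negPf->; rewrite mulr0z.
  rewrite nth_default // big1 // => i _.
  by rewrite gtn_eqF ?mulr0z // (leq_trans (ltn_ord i)).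
- by rewrite big1 // => i _; rewrite mulr0z.
- by rewrite IH1 IH2 -big_split; apply: eq_bigr => i _; rewrite mulrzDr.
- by rewrite IH1 -sumrN; apply: eq_bigr => i _; rewrite mulrNz.
Qed.

Lemma zeval_eq (V : zmodType) (e : seq V) (t1 t2 : zexpr) :
  all (fun i => zcoef t1 i == zcoef t2 i) (iota 0 (size e)) ->
  zeval V e t1 = zeval V e t2.
Proof.
move=> /allP eq_t12; rewrite !zevalE; apply: eq_bigr => i _; congr (_ *~ _).
by apply/eqP/eq_t12; rewrite mem_iota /=.
Qed.

(** The position of the atom [x] in the list [e]; fails when it is absent. *)
Ltac zindex e x :=
  lazymatch e with
  | x :: _ => constr:(0%N)
  | _ :: ?e' => let n := zindex e' x in constr:(S n)
  end.

(** The list [e] extended with the atoms of [t] that it lacks. *)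
Ltac zatoms e t :=
  lazymatch t with
  | 0 => e
  | ?t1 + ?t2 => let e1 := zatoms e t1 in zatoms e1 t2
  | - ?t1 => zatoms e t1
  | _ => match constr:(tt) with
         | _ => let n := zindex e t in e
         | _ => constr:(t :: e)
         end
  end.

(** The formal expression with value [t] for the list of atoms [e]. *)
Ltac zreify e t :=
  lazymatch t with
  | 0 => constr:(ZZero)
  | ?t1 + ?t2 =>
      let r1 := zreify e t1 in let r2 := zreify e t2 in constr:(ZAdd r1 r2)
  | - ?t1 => let r1 := zreify e t1 in constr:(ZOpp r1)
  | _ => let n := zindex e t in constr:(ZVar n)
  end.

(** Proves an equality of two expressions built from 0, sums and opposites that
    holds in every abelian group. *)
Ltac zmod_eq :=
  lazymatch goal with
  | |- @eq ?V ?t1 ?t2 =>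
      let e0 := zatoms (@nil V) t1 in
      let e := zatoms e0 t2 in
      let r1 := zreify e t1 in
      let r2 := zreify e t2 in
      apply: (zeval_eq _ e r1 r2); vm_compute; reflexivity
  end.

Lemma addrACA3 (V : zmodType) (a1 a2 b1 b2 c1 c2 : V) :
  (a1 + a2) + (b1 + b2) + (c1 + c2) = (a1 + b1 + c1) + (a2 + b2 + c2).
Proof. zmod_eq. Qed.

(** * Bilinear operations *)

Section Bilinear.

Context (K : fieldType) (L : lmodType K) (op : {bilinear L -> L -> L}).

Lemma bilinDl (x y z : L) : op (x + y) z = op x z + op y z.
Proof. exact: linearDl. Qed.

Lemma bilinDr (x y z : L) : op x (y + z) = op x y + op x z.
Proof. exact: linearDr. Qed.

Lemma bilinNl (x y : L) : op (- x) y = - op x y.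
Proof. exact: linearNl. Qed.

Lemma bilinNr (x y : L) : op x (- y) = - op x y.
Proof. exact: linearNr. Qed.

Lemma bilinZl (a : K) (x y : L) : op (a *: x) y = a *: op x y.
Proof. exact: linearZl_LR. Qed.

Lemma bilinZr (a : K) (x y : L) : op x (a *: y) = a *: op x y.
Proof. exact: linearZr. Qed.

Definition bilinE := (bilinDl, bilinDr, bilinNl, bilinNr, bilinZl, bilinZr).

End Bilinear.

(** * Identities of transposed Poisson algebras *)

Section TransposedPoisson.

Context {K : fieldType} {L : lmodType K} {mul br : {bilinear L -> L -> L}}.
Context (charK0 : [pchar K] =i pred0).
Context (tpL : transposed_poisson_algebra mul br).

Lemma tp_mulC (x y : L) : mul x y = mul y x.
Proof. by case: tpL => -[mulC _] _ _. Qed.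

Lemma tp_mulA (x y z : L) : mul (mul x y) z = mul x (mul y z).
Proof. by case: tpL => -[_ mulA] _ _. Qed.

Lemma tp_mulCA (x y z : L) : mul x (mul y z) = mul y (mul x z).
Proof. by rewrite -tp_mulA (tp_mulC x y) tp_mulA. Qed.

Lemma tp_brN (x y : L) : br x y = - br y x.
Proof.
case: tpL => _ [brxx _] _; apply/eqP; rewrite -addr_eq0.
have := brxx (x + y); rewrite !bilinE !brxx add0r addr0 => <-.
by rewrite addrC.
Qed.

Lemma tp_jacobi (x y z : L) : br (br x y) z + br (br y z) x + br (br z x) y = 0.
Proof.
case: tpL => _ [_ jac] _; rewrite -[RHS]oppr0 -(jac x y z).
rewrite (tp_brN (br x y)) (tp_brN (br y z)) (tp_brN (br z x)).
by zmod_eq.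
Qed.

Lemma tp_law (x y z : L) :
  mul z (br x y) + mul z (br x y) = br (mul z x) y + br x (mul z y).
Proof. by case: tpL => _ _ <-; rewrite scaler_nat mulr2n. Qed.

Lemma addxx_inj (x y : L) : x + x = y + y -> x = y.
Proof.
rewrite -!mulr2n -!scaler_nat; apply: scalerI.
by have := charK0 2; rewrite !inE /= => /negbT.
Qed.

Lemma cyclic_mul_br (x y z : L) :
  mul x (br y z) + mul y (br z x) + mul z (br x y) = 0.
Proof.
apply: addxx_inj.
transitivity ((mul x (br y z) + mul x (br y z)) +
  (mul y (br z x) + mul y (br z x)) + (mul z (br x y) + mul z (br x y))).
  by zmod_eq.
rewrite !tp_law (tp_mulC y x) (tp_mulC z x) (tp_mulC z y).
rewrite (tp_brN z) (tp_brN x) (tp_brN y).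
by zmod_eq.
Qed.

(** Multiplying the compatibility law for [z] by [w], and comparing with the law
    for [w z]. *)
Lemma mul2_br (w z a b : L) :
  mul w (mul z (br a b)) + mul w (mul z (br a b)) =
  br (mul z a) (mul w b) + br (mul w a) (mul z b).
Proof.
set m := mul w (mul z (br a b)).
have Ewz : m + m = br (mul w (mul z a)) b + br a (mul w (mul z b)).
  by rewrite /m -!tp_mulA tp_law.
have E4 : (m + m) + (m + m) =
    (br (mul w (mul z a)) b + br (mul z a) (mul w b)) +
    (br (mul w a) (mul z b) + br a (mul w (mul z b))).
  transitivity (mul w (br (mul z a) b + br a (mul z b)) +
    mul w (br (mul z a) b + br a (mul z b))).
    by rewrite -tp_law !bilinDr.
  by rewrite !bilinDr -!tp_law; zmod_eq.
apply: (addrI (m + m)); rewrite E4 Ewz; zmod_eq.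
Qed.

Lemma mul_br_swap (a b w z : L) :
  mul a (br z (mul b w)) - mul b (br z (mul a w)) = mul w (mul z (br a b)).
Proof.
apply: addxx_inj; rewrite mul2_br.
transitivity ((mul a (br z (mul b w)) + mul a (br z (mul b w))) -
  (mul b (br z (mul a w)) + mul b (br z (mul a w)))); first by zmod_eq.
rewrite !tp_law (tp_mulCA b a w) (tp_mulC a z) (tp_mulC b z).
rewrite (tp_mulC a w) (tp_mulC b w) (tp_brN (mul w a)).
by zmod_eq.
Qed.

Lemma cyclic_br_mul_br (h x y z : L) :
  br (mul h (br x y)) z + br (mul h (br y z)) x + br (mul h (br z x)) y = 0.
Proof.
pose S := br (mul h (br x y)) z + br (mul h (br y z)) x + br (mul h (br z x)) y.
pose Q := br (br x y) (mul h z) + br (br y z) (mul h x) + br (br z x) (mul h y).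
(* The product of the Jacobi identity by [h]. *)
have SQ : S + Q = 0.
  transitivity ((br (mul h (br x y)) z + br (br x y) (mul h z)) +
    (br (mul h (br y z)) x + br (br y z) (mul h x)) +
    (br (mul h (br z x)) y + br (br z x) (mul h y))).
    by rewrite /S /Q; zmod_eq.
  rewrite -!tp_law.
  have := congr1 (mul h) (tp_jacobi x y z); rewrite !bilinDr linear0r => jac.
  by rewrite -[RHS](addr0 0) -{1}jac -jac; zmod_eq.
(* The Jacobi identity with one of [x, y, z] multiplied by [h]. *)
have SSQ : S + S + Q = 0.
  transitivity
    (br (mul h (br x y) + mul h (br x y)) z +
     br (mul h (br y z) + mul h (br y z)) x +
     br (mul h (br z x) + mul h (br z x)) y + Q).
    by rewrite /S !bilinE; zmod_eq.
  rewrite !tp_law !bilinDl.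
  transitivity
    ((br (br (mul h x) y) z + br (br y z) (mul h x) + br (br z (mul h x)) y) +
     (br (br x (mul h y)) z + br (br (mul h y) z) x + br (br z x) (mul h y)) +
     (br (br x y) (mul h z) + br (br y (mul h z)) x + br (br (mul h z) x) y)).
    by rewrite /Q; zmod_eq.
  by rewrite !tp_jacobi !addr0.
by apply: (addIr (S + Q)); rewrite add0r addrA SSQ SQ.
Qed.

(** In the lemmas below, [a], [b], [p] and [q] stand for primed letters. *)

(** The part of the fundamental identity where [x'] and [y'] are primed. *)
Lemma part_xy (a b z u v : L) :
  mul (mul z (- br a b)) (br u v) =
  mul b (br z (mul a (br u v))) + mul a (br (mul b (br u v)) z).
Proof.
rewrite !bilinE tp_mulA (tp_mulC (br a b)) tp_mulCA -mul_br_swap.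
by rewrite (tp_brN _ z) bilinNr; zmod_eq.
Qed.

(** The part where [u'] and [v'] are primed. *)
Lemma part_uv (p q x y z : L) :
  mul (mul x (- br p q)) (br y z) + mul (mul y (- br p q)) (br z x) +
  mul (mul z (- br p q)) (br x y) = 0.
Proof.
rewrite !(tp_mulC _ (- br p q)) !tp_mulA -!bilinDr cyclic_mul_br.
exact: linear0r.
Qed.

(** The part where [x'] and [u'] are primed. *)
Lemma part_xu (a p y z v : L) :
  mul p (br v (mul a (br y z))) =
  mul (mul v (- br a p)) (br y z) + mul a (br (mul p (br v y)) z) +
  mul a (br y (mul p (br v z))).
Proof.
rewrite !bilinE tp_mulA (tp_mulC (br a p)) tp_mulCA -mul_br_swap.
have := congr1 (mul a) (cyclic_br_mul_br p v y z).
rewrite (tp_brN z v) (tp_brN (mul p _) v) (tp_brN (mul p _) y) !bilinE linear0r => E.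
by rewrite -[LHS]addr0 -E; zmod_eq.
Qed.

(** The part where [x'] and [v'] are primed. *)
Lemma part_xv (a q y z u : L) :
  mul q (br (mul a (br y z)) u) =
  mul (mul u (- br q a)) (br y z) + mul a (br (mul q (br y u)) z) +
  mul a (br y (mul q (br z u))).
Proof.
rewrite (tp_brN _ u) bilinNr part_xu (tp_brN q a) (tp_brN y u) (tp_brN z u).
by rewrite !bilinE; zmod_eq.
Qed.

End TransposedPoisson.

(** * The 3-Lie algebra *)

Theorem theorem4p10 (K : fieldType) (charK0 : [pchar K] =i pred0)
    (L : lmodType K) (mul br : {bilinear L -> L -> L})
    (tpL : transposed_poisson_algebra mul br)
    (f : {linear L -> L})
    (f_mul : forall x y : L, f (mul x y) = mul (f x) (f y))
    (f_invol : forall x : L, f (f x) = x)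
    (f_br : forall x y : L, f (br x y) = - br (f x) (f y)) :
  three_lie_algebra (fun x y z : L =>
    mul (f x) (br y z) + mul (f y) (br z x) + mul (f z) (br x y)).
Proof.
split.
- split=> [y z | x z | x y] c s t /=;
    rewrite !(linearD f) !(linearZ_LR f) !bilinE !scalerDr;
    exact: addrACA3.
- move=> x y z.
  by rewrite (tp_brN tpL y x) (tp_brN tpL z y) (tp_brN tpL x z) !bilinE;
    split; zmod_eq.
move=> x y z u v.
(* From here on, [f] is only applied to the five letters. *)
rewrite !(linearD f) !f_mul !f_invol !f_br.
have Exy := part_xy charK0 tpL (f x) (f y) z u v.
have Eyz := part_xy charK0 tpL (f y) (f z) x u v.
have Ezx := part_xy charK0 tpL (f z) (f x) y u v.
have Euv := part_uv charK0 tpL (f u) (f v) x y z.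
have Exu := part_xu charK0 tpL (f x) (f u) y z v.
have Eyu := part_xu charK0 tpL (f y) (f u) z x v.
have Ezu := part_xu charK0 tpL (f z) (f u) x y v.
have Exv := part_xv charK0 tpL (f x) (f v) y z u.
have Eyv := part_xv charK0 tpL (f y) (f v) z x u.
have Ezv := part_xv charK0 tpL (f z) (f v) x y u.
rewrite !(bilinDl, bilinDr) Exy Eyz Ezx Exu Eyu Ezu Exv Eyv Ezv.
by rewrite -[LHS]addr0 -Euv; zmod_eq.
Qed.
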